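(* Let $G_1=(V_1,E_1)$ be an exact simple unweighted graph without isolated vertices and let $G_2=(V_2,E_2)$ be a simple unweighted graph. Then the lexicographic product $G_1\bullet G_2$ is also exact, and $\phi(G_1\bullet G_2)=|V_2|^2\,\mathrm{MAXCUT}(G_1)$. Moreover, for every optimal rank-$r$ solution of the MAXCUT SDP of $G_1$, there exists an optimal rank-$r$ solution of the MAXCUT SDP of $G_1\bullet G_2$.
   Context: All graphs are finite with nonempty vertex set, simple and unweighted (every edge has weight $1$). The lexicographic product of $G_1=(V_1,E_1)$ and $G_2=(V_2,E_2)$ is the graph $G_1\bullet G_2$ with vertex set $V_1\times V_2$, where $(u,v)$ and $(u',v')$ are adjacent if either $uu'\in E_1$, or $u=u'$ and $vv'\in E_2$. The Laplacian $\mathcal{L}_G$ of a graph $G=(V,E)$ with edge weights $w_{ij}$ ($w_{ij}=0$ for non-edges) is the $V\times V$ matrix with off-diagonal entries $-w_{ij}$ and diagonal entries $\sum_{j\ne i}w_{ij}$. The MAXCUT SDP of $G$ is: maximize $\frac14\langle \mathcal{L}_G,\mathbf{X}\rangle$ over symmetric matrices $\mathbf{X}\in\mathbb{R}^{V\times V}$ with $X_{ii}=1$ for all $i\in V$ and $\mathbf{X}\succeq \mathbf{0}$, where $\langle \mathbf{A},\mathbf{B}\rangle=\operatorname{tr}(\mathbf{A}\mathbf{B})$. $\phi(G)$ denotes the optimal value of the MAXCUT SDP of $G$ (equivalently, of the Delorme--Poljak eigenvalue bound). $\mathrm{MAXCUT}(G)$ is the maximum, over partitions $(S,V\setminus S)$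 of $V$, of the total weight of edges with exactly one endpoint in $S$. $G$ is called exact if $\phi(G)=\mathrm{MAXCUT}(G)$; equivalently, if the MAXCUT SDP has an optimal solution of rank $1$. *)

(* Defs.v *)
From mathcomp Require Import all_boot all_order all_algebra.
From mathcomp Require Import classical_sets reals.

Set Implicit Arguments.
Unset Strict Implicit.
Unset Printing Implicit Defensive.

Import Order.TTheory GRing.Theory Num.Theory.
Local Open Scope ring_scope.

Record graph := Graph {
  vertex :> finType;
  edge : rel vertex;
  edge_sym : symmetric edge;
  edge_irrefl : irreflexive edge;
  graph_nonempty : (0 < #|vertex|)%N
}.

Arguments edge : clear implicits.

Definition no_isolated_vertex (G : graph) : Prop :=
  forall u : G, exists v : G, edge G u v.

Section LexicographicProduct.
Variables G1 G2 : graph.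

Definition lex_edge : rel (G1 * G2) := fun p q =>
  edge G1 p.1 q.1 || (p.1 == q.1) && edge G2 p.2 q.2.

Lemma lex_edge_sym : symmetric lex_edge.
Proof.
by move=> p q; rewrite /lex_edge edge_sym eq_sym (@edge_sym G2 p.2).
Qed.

Lemma lex_edge_irrefl : irreflexive lex_edge.
Proof. by move=> p; rewrite /lex_edge !edge_irrefl andbF. Qed.

Lemma lex_nonempty : (0 < #|{: G1 * G2}|)%N.
Proof. by rewrite card_prod muln_gt0 !graph_nonempty. Qed.

Definition lex_product : graph :=
  Graph lex_edge_sym lex_edge_irrefl lex_nonempty.

End LexicographicProduct.

Definition cut_weight (G : graph) (S : {set G}) : nat :=
  #|[set p : G * G | [&& p.1 \in S, p.2 \notin S & edge G p.1 p.2]]|.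

Definition maxcut (G : graph) : nat := \max_(S : {set G}) cut_weight S.

Section MaxcutSDP.
Variables (R : realType) (G : graph).

(* V x V matrices are encoded in 'M_#|V|: index i stands for the vertex
   enum_val i. *)
Definition edge_weight (i j : 'I_#|G|) : R :=
  (edge G (enum_val i) (enum_val j))%:R.

Definition laplacian : 'M[R]_#|G| :=
  \matrix_(i, j) if i == j then \sum_(k | k != i) edge_weight i k
                 else - edge_weight i j.

Definition psd n (X : 'M[R]_n) : Prop :=
  forall u : 'rV[R]_n, 0 <= (u *m X *m u^T) 0 0.

Definition sdp_feasible (X : 'M[R]_#|G|) : Prop :=
  [/\ X^T = X, forall i, X i i = 1 & psd X].

Definition sdp_objective (X : 'M[R]_#|G|) : R :=
  4^-1 * \tr (laplacian *m X).

Definition sdp_optimal (X : 'M[R]_#|G|) : Prop :=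
  sdp_feasible X /\
  forall Y, sdp_feasible Y -> sdp_objective Y <= sdp_objective X.

(* The feasible set is nonempty and compact, so this supremum is a maximum. *)
Definition phi : R := sup (sdp_objective @` [set X | sdp_feasible X])%classic.

Definition is_exact : Prop := phi = (maxcut G)%:R.

End MaxcutSDP.

Arguments phi : clear implicits.
Arguments is_exact : clear implicits.

(* Main.v *)
Require Import Defs.
From mathcomp Require Import all_boot all_order all_algebra.
From mathcomp Require Import classical_sets reals.
From mathcomp Require Import ring lra.

(** Write [w] for the adjacency matrix of [G1], [m = #|G2|], and let [x] be the
    sign vector of a maximum cut of [G1].  On feasible matrices the objective is
    a quarter of [\sum_i \sum_j w i j * (1 - X i j)], the sum running over
    ordered pairs.

    Lower bound and rank.  Repeating the entry [X i j] over all pairs of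
    vertices in the fibers of [i] and [j] lifts a feasible [X] of [G1] to a
    feasible matrix of the product.  The lift has the same rank; its entries
    within a fiber are 1, so the edges of the copies of [G2] contribute nothing
    and the objective is multiplied by [m ^+ 2].

    Upper bound.  Let [Y] be feasible for the product and let [Z] be its average
    over pairs of fibers.  Then [Z] is positive semidefinite with
    [Z i i <= 1].  Replacing each copy of [G2] by a complete graph can only
    increase the objective, so that [lex_objective_le] reduces to
      [\sum_ij w i j (1 - Z i j) + \sum_i (1 - Z i i)
         <= \sum_ij w i j (1 - x i x j)].
    Let [b i = \sum_j w i j x i x j] be the degree of [i] minus twice its
    number of cut edges.  Exactness says that [x] solves the semidefinite
    program, and two consequences finish the proof:
    - [balance_certificate]: [w - diag b] is nonnegative on every positive
      semidefinite [Z], that is, [\sum_i b i Z i i <= \sum_ij w i j Z i j];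
    - [balance_neighbour]: [b i <= -1] at every non-isolated vertex.
    Indeed the left side is then at most
    [\sum_ij w i j - \sum_i b i + \sum_i (b i + 1) (1 - Z i i)], where the last
    sum is nonpositive and [\sum_i b i = \sum_ij w i j x i x j].

    The certificate is the complementary dual solution, but it is obtained
    without strong duality: [x^T x] is perturbed inside the feasible set in the
    direction of [Z], and the first-order term of the objective is read off.
    The second consequence is the certificate for a [Z] of rank 1 supported on
    an edge at [i], combined with the integrality of [b i].  *)

Import Order.TTheory GRing.Theory Num.Theory.
Local Open Scope ring_scope.

(** * Positive semidefinite matrices and submatrices *)

Section Psd.
Set Implicit Arguments.
Unset Strict Implicit.
Variable R : realType.

Lemma psd_congr m n (B : 'M[R]_(m, n)) (X : 'M[R]_n) :
  psd X -> psd (B *m X *m B^T).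
Proof.
by move=> psdX u; have := psdX (u *m B); rewrite trmx_mul !mulmxA.
Qed.

Lemma psdD n (X Y : 'M[R]_n) : psd X -> psd Y -> psd (X + Y).
Proof.
by move=> pX pY u; rewrite mulmxDr mulmxDl mxE addr_ge0 ?pX ?pY.
Qed.

Lemma psd_outer n (v : 'rV[R]_n) : psd (v^T *m v).
Proof.
have psd1 : psd (1%:M : 'M[R]_1).
  by move=> u; rewrite mulmx1 mxE big_ord1 mxE -expr2 sqr_ge0.
by have := psd_congr v^T psd1; rewrite mulmx1 trmxK.
Qed.

Lemma psd_form n (X : 'M[R]_n) (v : 'rV[R]_n) :
  (v *m X *m v^T) 0 0 = \sum_i \sum_j v 0 i * v 0 j * X i j.
Proof.
rewrite mxE exchange_big /=; apply: eq_bigr => j _.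
by rewrite !mxE mulr_suml; apply: eq_bigr => i _; rewrite mulrAC.
Qed.

Lemma sum_two_point (n : nat) (i j : 'I_n) (s t : R) (F : 'I_n -> R) :
  \sum_k (s *+ (k == i) + t *+ (k == j)) * F k = s * F i + t * F j.
Proof.
under eq_bigr do rewrite mulrDl !mulrnAl !mulrb.
by rewrite big_split /= -!big_mkcond /= !big_pred1_eq.
Qed.

(** The value of the form at [s e_i + t e_j], kept in the factored form in which
    it is computed. *)
Lemma psd_pair n (X : 'M[R]_n) (i j : 'I_n) (s t : R) :
  psd X ->
  0 <= s * (s * X i i + t * X i j) + t * (s * X j i + t * X j j).
Proof.
move=> /(_ (\row_k (s *+ (k == i) + t *+ (k == j)))).
rewrite psd_form.
have -> // : \sum_k \sum_l
  (\row_k0 (s *+ (k0 == i) + t *+ (k0 == j))) 0 k *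
  (\row_k0 (s *+ (k0 == i) + t *+ (k0 == j))) 0 l * X k l =
   s * (s * X i i + t * X i j) + t * (s * X j i + t * X j j).
rewrite -(sum_two_point i j s t (fun k => s * X k i + t * X k j)).
apply: eq_bigr => k _; rewrite -(sum_two_point i j s t) mulr_sumr.
by apply: eq_bigr => l _; rewrite !mxE mulrA.
Qed.

Lemma psd_diag_ge0 n (X : 'M[R]_n) (i : 'I_n) : psd X -> 0 <= X i i.
Proof. by move=> /(psd_pair i i 1 0); rewrite !mul1r !mul0r !addr0. Qed.

Lemma psd_mxsub m n (f : 'I_m -> 'I_n) (X : 'M[R]_n) :
  psd X -> psd (mxsub f f X).
Proof.
move=> /(psd_congr (rowsub f 1%:M)).
rewrite trmx_mxsub trmx1 mul_rowsub_mx mul1mx mulmx_colsub mulmx1.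
by rewrite -mxsub_comp.
Qed.

Lemma mxrank_mxsub m n m' n' (f : 'I_m' -> 'I_m) (g : 'I_n' -> 'I_n)
  (X : 'M[R]_(m, n)) : (\rank (mxsub f g X) <= \rank X)%N.
Proof.
have rank_rowsub p q r (h : 'I_p -> 'I_q) (Y : 'M[R]_(q, r)) :
    (\rank (rowsub h Y) <= \rank Y)%N.
  exact: mxrankS (rowsub_sub _ _).
rewrite mxsubrc; apply: leq_trans (rank_rowsub _ _ _ _ _) _.
by rewrite -mxrank_tr trmx_mxsub -[leqRHS]mxrank_tr rank_rowsub.
Qed.

(** When [f] is onto, [X] is conversely a submatrix of [mxsub f f X], up to
    repetition of rows and columns. *)
Lemma mxrank_mxsub_retract m n (f : 'I_m -> 'I_n) (g : 'I_n -> 'I_m)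
  (X : 'M[R]_n) : cancel g f -> \rank (mxsub f f X) = \rank X.
Proof.
move=> gK; apply/eqP; rewrite eqn_leq mxrank_mxsub /=.
have {1}-> : X = mxsub g g (mxsub f f X).
  by apply/matrixP => i j; rewrite !mxE !gK.
exact: mxrank_mxsub.
Qed.

End Psd.

(** * Removing a vanishing damping factor *)

Section Damped.
Variable R : realType.

(** This is the passage to the limit [d -> 0], with an explicit rate: each
    damping factor lies between [1 - d * (a i + b i)] and [1], so the undamped
    sum is at most [d * C] for a fixed [C] and every positive [d]. *)
Lemma damped_sum_le0 (I : finType) (c a b : I -> R) :
  (forall i, 0 <= a i) -> (forall i, 0 <= b i) ->
  (forall d, 0 < d -> \sum_i c i / ((1 + d * a i) * (1 + d * b i)) <= 0) ->
  \sum_i c i <= 0.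
Proof.
move=> a0 b0 damped; rewrite leNgt; apply/negP => S0.
set S := \sum_i c i in S0.
pose C := \sum_i `|c i| * (a i + b i).
have C0 : 0 <= C by apply: sumr_ge0 => i _; rewrite mulr_ge0 ?addr_ge0.
have S_le d : 0 < d -> S <= d * C.
  move=> d0; rewrite -[d * C]addr0.
  apply: le_trans (lerD (lexx _) (damped d d0)).
  rewrite mulr_sumr -big_split /=; apply: ler_sum => i _.
  set A := d * a i; set B := d * b i.
  have A0 : 0 <= A by rewrite mulr_ge0 // ltW.
  have B0 : 0 <= B by rewrite mulr_ge0 // ltW.
  have AB0 : 0 <= A * B by rewrite mulr_ge0.
  have -> : d * (`|c i| * (a i + b i)) = `|c i| * (A + B).
    by rewrite /A /B; ring.
  set D := (1 + A) * (1 + B).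
  have D1 : 1 <= D by rewrite /D; nra.
  have D0 : 0 < D by lra.
  have [Dinv0 Dinv1 DinvAB] :
      [/\ 0 <= D^-1, D^-1 <= 1 & 1 - (A + B) <= D^-1].
    split; first by rewrite invr_ge0 ltW.
      by rewrite invf_le1.
    rewrite -[_ <= _](ler_pM2r D0) mulVf ?gt_eqF //.
    rewrite /D; nra.
  have := ler_norm (c i); have := lerNnormlW (lexx `|c i|).
  set n := `|c i|; set x := c i; move=> h1 h2.
  nra.
(* With this [d] the bound reads [S <= S * (C / (C + 1))], and [0 < S]. *)
have := S_le (S / (C + 1)).
rewrite divr_gt0 ?ltr_wpDl // => /(_ isT).
rewrite mulrAC ler_pdivlMr ?ltr_wpDl //; nra.
Qed.
End Damped.

(** * The semidefinite program of a single graph *)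

Section Sdp.
Set Implicit Arguments.
Unset Strict Implicit.
Variables (R : realType) (G : graph).
Local Notation w := (@edge_weight R G).

Lemma edge_weight_sym i j : w i j = w j i.
Proof. by rewrite /edge_weight edge_sym. Qed.

Lemma edge_weight_ii i : w i i = 0.
Proof. by rewrite /edge_weight edge_irrefl. Qed.

Lemma edge_weight_ge0 i j : 0 <= w i j.
Proof. exact: ler0n. Qed.

Lemma sdp_objectiveE (X : 'M[R]_#|G|) : sdp_feasible X ->
  sdp_objective X = 4^-1 * \sum_i \sum_j w i j * (1 - X i j).
Proof.
move=> [Xsym X1 _]; congr (_ * _); apply: eq_bigr => i _.
rewrite mxE (bigD1 i) //= [RHS](bigD1 i) //= mxE eqxx X1.
rewrite subrr mulr0 add0r mulr1 -big_split /=; apply: eq_bigr => j ji.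
by rewrite mxE eq_sym (negbTE ji) -{1}Xsym mxE mulrBr mulr1 mulNr.
Qed.

Lemma feasible_entry_bounds (X : 'M[R]_#|G|) i j :
  sdp_feasible X -> -1 <= X i j <= 1.
Proof.
move=> [Xsym X1 Xpsd].
have := psd_pair i j 1 1 Xpsd; have := psd_pair i j 1 (-1) Xpsd.
have -> : X j i = X i j by rewrite -{1}Xsym mxE.
rewrite !X1; lra.
Qed.

(** The supremum of an unbounded set has a default value, so nothing can be
    deduced from [phi] before boundedness is known. *)
Lemma feasible_objective_bounded :
  exists M : R, forall X : 'M[R]_#|G|, sdp_feasible X -> sdp_objective X <= M.
Proof.
exists (4^-1 * \sum_i \sum_j w i j * 2) => X Xf.
rewrite sdp_objectiveE // ler_pM2l ?invr_gt0 ?ltr0n //.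
apply: ler_sum => i _; apply: ler_sum => j _.
have := feasible_entry_bounds i j Xf; have := edge_weight_ge0 i j; nra.
Qed.

Lemma feasible_le_phi (X : 'M[R]_#|G|) :
  sdp_feasible X -> sdp_objective X <= phi R G.
Proof.
move=> Xf; have [M bM] := feasible_objective_bounded.
apply: ub_le_sup; last by exists X.
by exists M => _ [Y Yf <-]; exact: bM.
Qed.

Lemma phi_eq_max (X : 'M[R]_#|G|) : sdp_optimal X -> phi R G = sdp_objective X.
Proof.
move=> [Xf Xopt]; apply/eqP; rewrite eq_le feasible_le_phi // andbT.
by apply: ge_sup => [|_ [Y Yf <-]]; [exists (sdp_objective X), X | exact: Xopt].
Qed.

Definition cut_sign (S : {set G}) : 'rV[R]_#|G| :=
  \row_i (-1) ^+ (enum_val i \in S).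

Definition cut_mx (S : {set G}) : 'M[R]_#|G| := (cut_sign S)^T *m cut_sign S.

Lemma cut_mxE S i j : cut_mx S i j = cut_sign S 0 i * cut_sign S 0 j.
Proof. by rewrite mxE big_ord1 !mxE. Qed.

Lemma cut_sign_sqr S i : cut_sign S 0 i * cut_sign S 0 i = 1.
Proof. by rewrite mxE -expr2 sqrr_sign. Qed.

Lemma cut_mx_feasible S : sdp_feasible (cut_mx S).
Proof.
split; first by rewrite trmx_mul trmxK.
  by move=> i; rewrite cut_mxE cut_sign_sqr.
exact: psd_outer.
Qed.

Lemma cut_weightE (S : {set G}) : (cut_weight S)%:R =
  \sum_i \sum_j w i j * (enum_val i \in S)%:R * (1 - (enum_val j \in S)%:R).
Proof.
rewrite /cut_weight cardsE -sum1_card natr_sum big_mkcond /=.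
rewrite -(pair_bigA _ (fun u v : G =>
  if [&& u \in S, v \notin S & edge G u v] then 1%R else 0%R : R)) /=.
rewrite (reindex _ (onW_bij _ (enum_val_bij _))) /=; apply: eq_bigr => i _.
rewrite (reindex _ (onW_bij _ (enum_val_bij _))) /=; apply: eq_bigr => j _.
rewrite /edge_weight.
by case: (_ \in S); case: (_ \in S); case: edge; rewrite /=; ring.
Qed.

Lemma cut_mx_objective S : sdp_objective (cut_mx S) = (cut_weight S)%:R.
Proof.
rewrite sdp_objectiveE; last exact: cut_mx_feasible.
(* Ordered pairs see each cut edge twice, once from either side. *)
pose F i j := w i j * (enum_val i \in S)%:R * (1 - (enum_val j \in S)%:R).
have -> : \sum_i \sum_j w i j * (1 - cut_mx S i j) =
          2 * \sum_i \sum_j F i j + 2 * \sum_i \sum_j F j i.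
  rewrite !mulr_sumr -big_split /=; apply: eq_bigr => i _.
  rewrite !mulr_sumr -big_split /=; apply: eq_bigr => j _.
  rewrite cut_mxE !mxE /F (edge_weight_sym j i).
  by case: (_ \in S); case: (_ \in S); rewrite /=; ring.
rewrite [X in _ + 2 * X]exchange_big /= cut_weightE /F.
by field.
Qed.

Lemma maxcut_attained : exists S : {set G}, maxcut G = cut_weight S.
Proof.
have [|S] := @bigop.eq_bigmax {set G} (@cut_weight G); last by exists S.
by apply/card_gt0P; exists finset.set0.
Qed.

Lemma cut_weight_le_maxcut (S : {set G}) : (cut_weight S <= maxcut G)%N.
Proof. exact: leq_bigmax. Qed.

(** * Optimality certificate of a sign vector *)

Section Certificate.
Variable x : 'rV[R]_#|G|.
Hypothesis x_sqr : forall i, x 0 i * x 0 i = 1.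
Hypothesis x_opt : forall X : 'M[R]_#|G|, sdp_feasible X ->
  \sum_i \sum_j w i j * (1 - X i j) <=
  \sum_i \sum_j w i j * (1 - x 0 i * x 0 j).

(** The degree of [i] minus twice its number of edges cut by [x]. *)
Definition balance (i : 'I_#|G|) : R := \sum_j w i j * (x 0 i * x 0 j).

(** The Gram matrix obtained from the unit vectors [x i] by a perturbation of
    size [e] in the direction of a Gram representation of [Z].  With
    [a i = e ^+ 2 * Z i i], it is [c i * c j + t i * t j * Z i j] for
    [c i = x i * (1 - a i) / (1 + a i)] and [t i = 2 * e / (1 + a i)].  This
    rational parametrization of the circle gives
    [c i ^+ 2 + t i ^+ 2 * Z i i = 1] without square roots. *)
Definition perturbed_cut (e : R) (Z : 'M[R]_#|G|) : 'M[R]_#|G| :=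
  \matrix_(i, j)
    ((x 0 i * x 0 j * ((1 - e ^+ 2 * Z i i) * (1 - e ^+ 2 * Z j j)) +
     4 * e ^+ 2 * Z i j) / ((1 + e ^+ 2 * Z i i) * (1 + e ^+ 2 * Z j j))).

Lemma perturbed_cut_feasible (e : R) (Z : 'M[R]_#|G|) : Z^T = Z -> psd Z ->
  sdp_feasible (perturbed_cut e Z).
Proof.
move=> Zsym Zpsd.
have D0 i : 1 + e ^+ 2 * Z i i != 0.
  by rewrite gt_eqF // ltr_wpDr // mulr_ge0 ?sqr_ge0 ?psd_diag_ge0.
pose v : 'rV[R]_#|G| :=
  \row_i (x 0 i * (1 - e ^+ 2 * Z i i) / (1 + e ^+ 2 * Z i i)).
pose t : 'rV[R]_#|G| := \row_i (2 * e / (1 + e ^+ 2 * Z i i)).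
have XE : perturbed_cut e Z = v^T *m v + diag_mx t *m Z *m (diag_mx t)^T.
  apply/matrixP => i j; rewrite tr_diag_mx mul_mx_diag mul_diag_mx.
  by rewrite !mxE big_ord1 !mxE; field; rewrite !D0.
split.
- apply/matrixP => i j; rewrite !mxE.
  have -> : Z j i = Z i j by rewrite -{1}Zsym mxE.
  by rewrite [x 0 j * _]mulrC [(1 - _) * (1 - _)]mulrC [(1 + _) * (1 + _)]mulrC.
- move=> i; rewrite mxE x_sqr mul1r; field; exact: D0.
- by rewrite XE; apply: psdD; [exact: psd_outer | exact: psd_congr].
Qed.

(** [x i * x j - perturbed_cut e Z i j] is exactly [2 * e ^+ 2 * x i * x j *
    (Z i i + Z j j - 2 * x i * x j * Z i j)], damped by the factors of
    [damped_sum_le0].  As [x] is optimal, the sum of these differences weighted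
    by [w] is nonpositive for every [e], hence also without the damping. *)
Lemma balance_certificate (Z : 'M[R]_#|G|) : Z^T = Z -> psd Z ->
  \sum_i balance i * Z i i <= \sum_i \sum_j w i j * Z i j.
Proof.
move=> Zsym Zpsd.
pose c (p : 'I_#|G| * 'I_#|G|) := w p.1 p.2 * (x 0 p.1 * x 0 p.2 *
  (Z p.1 p.1 + Z p.2 p.2) - 2 * Z p.1 p.2).
have c_le0 : \sum_p c p <= 0.
  apply: (@damped_sum_le0 R _ c (fun p => Z p.1 p.1) (fun p => Z p.2 p.2)).
  - by move=> p; exact: psd_diag_ge0.
  - by move=> p; exact: psd_diag_ge0.
  move=> d d0; pose e := Num.sqrt d.
  have := x_opt (perturbed_cut_feasible e Zsym Zpsd).
  have ed : e ^+ 2 = d by rewrite sqr_sqrtr ?ltW.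
  rewrite -subr_le0 => h.
  rewrite -(ler_pM2l (mulr_gt0 (ltr0n R 2) d0)) mulr0.
  apply: le_trans h; rewrite le_eqVlt; apply/orP; left; apply/eqP.
  rewrite mulr_sumr -(pair_bigA _ (fun i j => 2%:R * d * (c (i, j) /
    ((1 + d * Z i i) * (1 + d * Z j j))))) -sumrB /=.
  apply: eq_bigr => i _; rewrite -sumrB; apply: eq_bigr => j _.
  rewrite mxE ed /c /=.
  have D0 k : 1 + d * Z k k != 0.
    by rewrite gt_eqF // ltr_wpDr // mulr_ge0 ?psd_diag_ge0 // ltW.
  by field; rewrite !D0.
have : \sum_p c p =
    2 * (\sum_i balance i * Z i i - \sum_i \sum_j w i j * Z i j).
  have bal : \sum_i balance i * Z i i =
      \sum_i \sum_j w i j * (x 0 i * x 0 j) * Z i i.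
    by apply: eq_bigr => i _; rewrite mulr_suml.
  have bal' : \sum_i balance i * Z i i =
      \sum_i \sum_j w i j * (x 0 i * x 0 j) * Z j j.
    rewrite bal exchange_big /=; apply: eq_bigr => i _; apply: eq_bigr => j _.
    by rewrite edge_weight_sym [x 0 j * _]mulrC.
  rewrite mulrBr [2 * \sum_i balance i * _]mulr_natl mulr2n {1}bal bal'.
  rewrite mulr_sumr -big_split -sumrB /=.
  rewrite -(pair_bigA _ (fun i j => c (i, j))) /=.
  apply: eq_bigr => i _; rewrite mulr_sumr -big_split -sumrB /=.
  by apply: eq_bigr => j _; rewrite /c /=; ring.
lra.
Qed.

Lemma balance_int i : balance i \is a Num.int.
Proof.
have x_int k : x 0 k \is a Num.int.
  have /eqP := x_sqr k; rewrite -expr2 sqrf_eq1.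
  by case/orP => /eqP ->; rewrite ?rpredN rpred1.
by apply: rpred_sum => j _; rewrite !rpredM ?x_int // /edge_weight rpred_nat.
Qed.

(** At [s e_i + e_j] the certificate reads [s ^+ 2 * b i + b j <= 2 * s].  If
    [b i] were nonnegative, this would fail for [s] very negative; so [b i] is a
    negative integer. *)
Lemma balance_neighbour (i j : 'I_#|G|) : w i j = 1 -> balance i <= -1.
Proof.
move=> wij.
have ij : (i == j) = false.
  apply/eqP => ij; move: wij; rewrite ij edge_weight_ii => /esym/eqP.
  by rewrite oner_eq0.
have form s : s ^+ 2 * balance i + balance j <= 2 * s.
  pose v : 'rV[R]_#|G| := \row_k (s *+ (k == i) + 1 *+ (k == j)).
  have := balance_certificate (Z := v^T *m v).
  rewrite trmx_mul trmxK => /(_ erefl (psd_outer v)).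
  have vE k l : (v^T *m v) k l = v 0 k * v 0 l by rewrite mxE big_ord1 mxE.
  have -> : \sum_k balance k * (v^T *m v) k k = s ^+ 2 * balance i + balance j.
    transitivity (\sum_k (s *+ (k == i) + 1 *+ (k == j)) * (v 0 k * balance k)).
      by apply: eq_bigr => k _; rewrite vE {1}mxE; ring.
    by rewrite sum_two_point !mxE !eqxx [j == i]eq_sym ij /= mulr0n; ring.
  have -> : \sum_k \sum_l w k l * (v^T *m v) k l = 2 * s.
    transitivity (\sum_k (s *+ (k == i) + 1 *+ (k == j)) *
      (s * w k i + 1 * w k j)).
      apply: eq_bigr => k _; rewrite -(sum_two_point i j s 1) mulr_sumr.
      by apply: eq_bigr => l _; rewrite vE !mxE; ring.
    by rewrite sum_two_point !edge_weight_ii (edge_weight_sym j) wij; ring.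
  by [].
have bi0 : balance i < 0.
  rewrite ltNge; apply/negP => bi0.
  have := form (- (1 + `|balance j|)).
  have := lerNnormlW (lexx `|balance j|); have := normr_ge0 (balance j).
  set n := `|_| => n0 hn; set s := - _ => hs.
  have := mulr_ge0 (sqr_ge0 s) bi0; rewrite /s in hs *; lra.
move: bi0; have /intrP [z ->] := balance_int i.
by rewrite ltrz0 -(rmorphN1 (intr : int -> R)) ler_int -ltzD1 addNr.
Qed.
End Certificate.

End Sdp.

(** * Lifting to and averaging over the lexicographic product *)

Section Lexicographic.
Set Implicit Arguments.
Unset Strict Implicit.
Variables (R : realType) (G1 G2 : graph).
Local Notation G := (lex_product G1 G2).
Local Notation m := (#|G2|%:R : R).
Local Notation w1 := (@edge_weight R G1).
Local Notation w2 := (@edge_weight R G2).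

Definition lex_fst (p : 'I_#|G|) : 'I_#|G1| :=
  enum_rank (enum_val p : G1 * G2)%type.1.

Definition lex_pair (i : 'I_#|G1|) (k : 'I_#|G2|) : 'I_#|G| :=
  enum_rank ((enum_val i, enum_val k) : G).

Lemma lex_fst_pair i k : lex_fst (lex_pair i k) = i.
Proof. by rewrite /lex_fst /lex_pair enum_rankK enum_valK. Qed.

Lemma sum_lex (F : 'I_#|G| -> R) : \sum_p F p = \sum_i \sum_k F (lex_pair i k).
Proof.
rewrite (reindex _ (onW_bij _ (enum_rank_bij G))) /=.
transitivity (\sum_(u : G1) \sum_(v : G2) F (enum_rank ((u, v) : G))).
  by rewrite pair_bigA /=; apply: eq_bigr => -[].
rewrite (reindex _ (onW_bij _ (enum_val_bij G1))) /=; apply: eq_bigr => i _.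
by rewrite (reindex _ (onW_bij _ (enum_val_bij G2))).
Qed.

Lemma lex_weight i k j l :
  edge_weight R (lex_pair i k) (lex_pair j l) = w1 i j + (i == j)%:R * w2 k l.
Proof.
rewrite /edge_weight /lex_pair !enum_rankK /= /lex_edge /=.
rewrite (inj_eq enum_val_inj).
case: eqP => [->|_] /=; rewrite ?edge_irrefl /=; first by ring.
by rewrite orbF; ring.
Qed.

(** The first sum collects the edges inherited from [G1], the second those of
    the copies of [G2]. *)
Lemma sum_lex_weight (F : 'I_#|G| -> 'I_#|G| -> R) :
  \sum_p \sum_q edge_weight R p q * F p q =
  \sum_i \sum_j w1 i j * (\sum_k \sum_l F (lex_pair i k) (lex_pair j l)) +
  \sum_i \sum_k \sum_l w2 k l * F (lex_pair i k) (lex_pair i l).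
Proof.
rewrite sum_lex -big_split /=; apply: eq_bigr => i _.
transitivity (\sum_k \sum_j \sum_l
  (w1 i j + (i == j)%:R * w2 k l) * F (lex_pair i k) (lex_pair j l)).
  apply: eq_bigr => k _; rewrite sum_lex; apply: eq_bigr => j _.
  by apply: eq_bigr => l _; rewrite lex_weight.
transitivity (\sum_k (\sum_j w1 i j * (\sum_l F (lex_pair i k) (lex_pair j l)) +
  \sum_l w2 k l * F (lex_pair i k) (lex_pair i l))).
  apply: eq_bigr => k _.
  have -> : \sum_l w2 k l * F (lex_pair i k) (lex_pair i l) =
      \sum_j (i == j)%:R * (\sum_l w2 k l * F (lex_pair i k) (lex_pair j l)).
    rewrite (bigD1 i) //= eqxx mul1r [X in _ + X]big1 ?addr0 // => j.
    by rewrite eq_sym => /negbTE ->; rewrite mul0r.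
  rewrite -big_split /=; apply: eq_bigr => j _.
  rewrite !mulr_sumr -big_split /=; apply: eq_bigr => l _.
  by rewrite mulrDl mulrA.
rewrite big_split /=; congr (_ + _).
by rewrite exchange_big /=; apply: eq_bigr => j _; rewrite mulr_sumr.
Qed.

Lemma lift_feasible (X : 'M[R]_#|G1|) :
  sdp_feasible X -> sdp_feasible (mxsub lex_fst lex_fst X : 'M[R]_#|G|).
Proof.
move=> [Xsym X1 Xpsd]; split; first by rewrite trmx_mxsub Xsym.
  by move=> p; rewrite mxE.
exact: psd_mxsub.
Qed.

Lemma lift_objective (X : 'M[R]_#|G1|) : sdp_feasible X ->
  sdp_objective (mxsub lex_fst lex_fst X : 'M[R]_#|G|) =
  m ^+ 2 * sdp_objective X.
Proof.
move=> Xf; rewrite (sdp_objectiveE (lift_feasible Xf)) sdp_objectiveE // mulrCA.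
congr (_ * _); rewrite sum_lex_weight [X in _ + X]big1 ?addr0; last first.
  move=> i _; rewrite big1 // => k _; rewrite big1 // => l _.
  by rewrite mxE !lex_fst_pair; case: Xf => _ -> _; rewrite subrr mulr0.
rewrite mulr_sumr; apply: eq_bigr => i _.
rewrite mulr_sumr; apply: eq_bigr => j _.
under eq_bigr do under eq_bigr do rewrite mxE !lex_fst_pair.
by rewrite !sumr_const !card_ord; ring.
Qed.

Lemma lift_rank (X : 'M[R]_#|G1|) : \rank (mxsub lex_fst lex_fst X) = \rank X.
Proof.
have k0 : 'I_#|G2| by exists 0%N; exact: graph_nonempty.
exact: (@mxrank_mxsub_retract _ _ _ _ (lex_pair^~ k0)) (lex_fst_pair^~ k0).
Qed.

(** The union of the fibers over a maximum cut of [G1]; its size is computed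
    through the objective, since its cut matrix is the lift of that of the cut
    below. *)
Lemma lex_maxcut_ge : (#|G2| ^ 2 * maxcut G1 <= maxcut G)%N.
Proof.
have [S ->] := maxcut_attained G1.
pose T : {set G} := [set p : G | (p : G1 * G2)%type.1 \in S].
apply: leq_trans (cut_weight_le_maxcut T).
rewrite -(ler_nat R) natrM natrX -!(cut_mx_objective R).
rewrite -lift_objective; last exact: cut_mx_feasible.
rewrite le_eqVlt; apply/orP; left; apply/eqP; congr sdp_objective.
by apply/matrixP => p q; rewrite mxE !cut_mxE !mxE !inE !enum_rankK.
Qed.

Definition fiber_mean (Y : 'M[R]_#|G|) : 'M[R]_#|G1| :=
  \matrix_(i, j) (m ^- 2 * \sum_k \sum_l Y (lex_pair i k) (lex_pair j l)).

Lemma fiber_card_gt0 : 0 < m.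
Proof. by rewrite ltr0n graph_nonempty. Qed.

(** Averaging is congruence by the matrix [B] that takes means over fibers. *)
Lemma fiber_mean_psd Y : psd Y -> psd (fiber_mean Y).
Proof.
pose B : 'M[R]_(#|G1|, #|G|) := \matrix_(i, p) (m^-1 *+ (lex_fst p == i)).
move=> /(psd_congr B); congr psd; apply/matrixP => i j.
have sumB a (F : 'I_#|G| -> R) :
    \sum_p B a p * F p = m^-1 * \sum_k F (lex_pair a k).
  rewrite sum_lex (bigD1 a) //= [X in _ + X]big1 ?addr0 => [|b ba].
    by rewrite mulr_sumr; apply: eq_bigr => k _; rewrite mxE lex_fst_pair eqxx.
  by apply: big1 => k _; rewrite mxE lex_fst_pair (negbTE ba) mul0r.
rewrite [RHS]mxE [LHS]mxE.
transitivity (\sum_q B j q * \sum_p B i p * Y p q).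
  by apply: eq_bigr => q _; rewrite mulrC [B^T _ _]mxE [(B *m Y) _ _]mxE.
rewrite sumB; under eq_bigr do rewrite sumB.
by rewrite -mulr_sumr exchange_big mulrA -invfM.
Qed.

Lemma fiber_mean_sym Y : Y^T = Y -> (fiber_mean Y)^T = fiber_mean Y.
Proof.
move=> Ysym; apply/matrixP => i j; rewrite !mxE exchange_big /=; congr (_ * _).
by apply: eq_bigr => k _; apply: eq_bigr => l _; rewrite -{1}Ysym mxE.
Qed.

(** For [i = j] the left side is also an upper bound for what the copy of [G2]
    over [i] contributes to the objective, its terms being nonnegative. *)
Lemma fiber_mean_compl (Y : 'M[R]_#|G|) i j :
  \sum_k \sum_l (1 - Y (lex_pair i k) (lex_pair j l)) =
  m ^+ 2 * (1 - fiber_mean Y i j).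
Proof.
under eq_bigr do rewrite sumrB sumr_const card_ord.
rewrite sumrB sumr_const card_ord mxE.
by field; rewrite gt_eqF ?fiber_card_gt0.
Qed.

(** Bounding the copies of [G2] by complete graphs costs
    [m ^+ 2 * \sum_i (1 - Z i i)] with [Z] the fiber average; the certificate
    leaves a slack of [- b i >= 1] on each [1 - Z i i], which pays for it. *)
Lemma lex_objective_le (Y : 'M[R]_#|G|) :
  is_exact R G1 -> no_isolated_vertex G1 -> sdp_feasible Y ->
  sdp_objective Y <= m ^+ 2 * (maxcut G1)%:R.
Proof.
move=> exact1 noiso Yf.
have Y_le1 p q : 0 <= 1 - Y p q.
  by rewrite subr_ge0; case/andP: (feasible_entry_bounds p q Yf).
have m20 : 0 < m ^+ 2 by rewrite exprn_gt0 ?fiber_card_gt0.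
have [S maxS] := maxcut_attained G1.
pose x := cut_sign R S.
pose V := \sum_i \sum_j w1 i j * (1 - x 0 i * x 0 j).
have VE : (maxcut G1)%:R = 4^-1 * V.
  rewrite maxS -cut_mx_objective sdp_objectiveE; last exact: cut_mx_feasible.
  congr (_ * _); apply: eq_bigr => i _; apply: eq_bigr => j _.
  by rewrite cut_mxE.
have x_sqr := cut_sign_sqr R S.
have x_opt (X : 'M[R]_#|G1|) : sdp_feasible X ->
    \sum_i \sum_j w1 i j * (1 - X i j) <= V.
  move=> Xf; have := feasible_le_phi Xf.
  by rewrite exact1 VE sdp_objectiveE // ler_pM2l ?invr_gt0 ?ltr0n.
pose Z := fiber_mean Y.
have Zpsd : psd Z by apply: fiber_mean_psd; case: Yf.
have Zsym : Z^T = Z by apply: fiber_mean_sym; case: Yf.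
have Zii i : 0 <= 1 - Z i i.
  rewrite -(pmulr_rge0 _ m20) -fiber_mean_compl.
  apply: sumr_ge0 => k _; apply: sumr_ge0 => l _.
  exact: Y_le1.
have b_le i : balance x i <= -1.
  have [v uv] := noiso (enum_val i).
  apply: (balance_neighbour x_sqr x_opt (j := enum_rank v)).
  by rewrite /edge_weight enum_rankK uv.
have cert := balance_certificate x_sqr x_opt Zsym Zpsd.
rewrite sdp_objectiveE // VE mulrCA ler_pM2l ?invr_gt0 ?ltr0n //.
rewrite sum_lex_weight.
under eq_bigr do under eq_bigr do rewrite fiber_mean_compl.
apply: (@le_trans _ _ (m ^+ 2 *
   (\sum_i \sum_j w1 i j * (1 - Z i j) + \sum_i (1 - Z i i)))).
  rewrite mulrDr !mulr_sumr lerD //.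
    apply: ler_sum => i _; rewrite mulr_sumr; apply: ler_sum => j _.
    by rewrite mulrCA.
  apply: ler_sum => i _; rewrite -fiber_mean_compl.
  apply: ler_sum => k _; apply: ler_sum => l _.
  by rewrite ler_piMl ?lern1 ?leq_b1.
rewrite ler_pM2l //.
have splitw (F : 'I_#|G1| -> 'I_#|G1| -> R) :
    \sum_i \sum_j w1 i j * (1 - F i j) =
    \sum_i \sum_j w1 i j - \sum_i \sum_j w1 i j * F i j.
  rewrite -sumrB; apply: eq_bigr => i _; rewrite -sumrB; apply: eq_bigr => j _.
  by rewrite mulrBr mulr1.
rewrite /V !splitw.
have : \sum_i (1 - Z i i) <= \sum_i balance x i * Z i i - \sum_i balance x i.
  rewrite -sumrB; apply: ler_sum => i _.
  have := Zii i; have := b_le i; nra.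
rewrite /balance in cert *; lra.
Qed.

End Lexicographic.

(** * Exactness of the product *)

Theorem theorem12 (R : realType) (G1 G2 : graph)
  (exact_G1 : is_exact R G1)
  (G1_no_isolated : no_isolated_vertex G1) :
  [/\ is_exact R (lex_product G1 G2),
      phi R (lex_product G1 G2) = (#|G2| ^ 2 * maxcut G1)%:R
    & forall (r : nat) (X : 'M[R]_#|G1|),
        sdp_optimal X -> \rank X = r ->
        exists Y : 'M[R]_#|lex_product G1 G2|,
          sdp_optimal Y /\ \rank Y = r].
Proof.
have lift_optimal (X : 'M[R]_#|G1|) : sdp_feasible X ->
    sdp_objective X = (maxcut G1)%:R ->
    sdp_optimal (mxsub (@lex_fst G1 G2) (@lex_fst G1 G2) X).
  move=> Xf objX; split; first exact: lift_feasible.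
  by move=> Y Yf; rewrite lift_objective // objX lex_objective_le.
have [S maxS] := maxcut_attained G1.
have Sf := cut_mx_feasible R S.
have objS : sdp_objective (cut_mx R S) = (maxcut G1)%:R.
  by rewrite cut_mx_objective maxS.
have phiE : phi R (lex_product G1 G2) = (#|G2| ^ 2 * maxcut G1)%:R.
  rewrite (phi_eq_max (lift_optimal _ Sf objS)) lift_objective // objS.
  by rewrite natrM natrX.
split=> //; last first.
  move=> r X Xopt rankX.
  exists (mxsub (@lex_fst G1 G2) (@lex_fst G1 G2) X).
  split; last by rewrite lift_rank.
  apply: lift_optimal; first by case: Xopt.
  by rewrite -(phi_eq_max Xopt).
apply/eqP; rewrite eq_le {1}phiE ler_nat (lex_maxcut_ge R) /=.
have [T ->] := maxcut_attained (lex_product G1 G2).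
by rewrite -(cut_mx_objective R) feasible_le_phi //; exact: cut_mx_feasible.
Qed.
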